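(* For every $n\ge 1$ there is a bijection between the set $\mathcal{DU}_{2n}(4123)$ and the set of standard Young tableaux of shape $(n,n,n)$ such that, for every $\pi=\pi_1\pi_2\ldots\pi_{2n}\in\mathcal{DU}_{2n}(4123)$, the $(1,n)$-entry of the tableau corresponding to $\pi$ is equal to $3n-\pi_1$.
   Context: A permutation $\pi=\pi_1\cdots\pi_m$ of $[m]=\{1,\ldots,m\}$ is down-up alternating if $\pi_1>\pi_2<\pi_3>\pi_4<\cdots$; it avoids the pattern $4123$ if no subsequence $\pi_{i_1}\pi_{i_2}\pi_{i_3}\pi_{i_4}$ ($i_1<i_2<i_3<i_4$) satisfies $\pi_{i_2}<\pi_{i_3}<\pi_{i_4}<\pi_{i_1}$. $\mathcal{DU}_m(4123)$ is the set of $4123$-avoiding down-up alternating permutations of $[m]$. A standard Young tableau of shape $(n,n,n)$ is a filling of the left-justified array with three rows of $n$ boxes by $1,\ldots,3n$, each used once, increasing along rows and down columns. The $(i,j)$-entry is the entry in row $i$, column $j$. *)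

(* Defs.v *)
From mathcomp Require Import all_boot all_fingroup all_algebra.

Set Implicit Arguments.
Unset Strict Implicit.
Unset Printing Implicit Defensive.

(* A permutation of {1, ..., m} is represented by p : 'S_m acting on
   {0, ..., m-1}: pi_(k+1) is (p k).+1.  Hence pi_1 > pi_2 < pi_3 > ... is a
   descent at each even 0-based position and an ascent at each odd one. *)
Definition down_up (m : nat) (p : 'S_m) : bool :=
  [forall i : 'I_m, forall j : 'I_m,
    (j == i.+1 :> nat) ==> (if odd i then p i < p j else p j < p i)].

Definition contains_4123 (m : nat) (p : 'S_m) : bool :=
  [exists i1 : 'I_m, exists i2 : 'I_m, exists i3 : 'I_m, exists i4 : 'I_m,
    [&& i1 < i2, i2 < i3, i3 < i4, p i2 < p i3, p i3 < p i4 & p i4 < p i1]].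

Definition DU4123 (m : nat) : Type :=
  {p : 'S_m | down_up p && ~~ contains_4123 p}.

Definition is_rect_SYT (r c : nat) (T : 'M[nat]_(r, c)) : bool :=
  [&& perm_eq [seq T x.1 x.2 | x : 'I_r * 'I_c] (iota 1 (r * c)),
      [forall i : 'I_r, forall j1 : 'I_c, forall j2 : 'I_c,
        (j1 < j2) ==> (T i j1 < T i j2)]
    & [forall j : 'I_c, forall i1 : 'I_r, forall i2 : 'I_r,
        (i1 < i2) ==> (T i1 j < T i2 j)]].

Definition SYT3 (n : nat) : Type := {T : 'M[nat]_(3, n) | is_rect_SYT T}.

Lemma mul2n_gt0 (n : nat) : 0 < n -> 0 < 2 * n.
Proof. by rewrite muln_gt0. Qed.

Lemma predn_ltn (n : nat) : 0 < n -> n.-1 < n.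
Proof. by rewrite ltn_predL. Qed.

Definition first_letter (n : nat) (hn : 0 < n) (pi : DU4123 (2 * n)) : nat :=
  (val pi (Ordinal (mul2n_gt0 hn))).+1.

Definition entry1n (n : nat) (hn : 0 < n) (T : SYT3 n) : nat :=
  val T ord0 (Ordinal (predn_ltn hn)).

(* Main.v *)
Require Import Defs.
From mathcomp Require Import all_boot all_fingroup all_algebra.
From mathcomp Require Import zify.
From Stdlib Require Import ClassicalEpsilon.

(** Both families are grown along the same tree. A 4123-avoiding down-up
    permutation is built by prepending a pair of letters [a > b] to a smaller
    one, and whether the result is admissible depends only on the first letter
    [k] of the smaller permutation and on the set [S] of the [z] such that
    [z, z + 1] occur in this order and [z + 1 < k]: these ascents dominate all
    ascents below [k]. A tableau is read as its word of row indices; a larger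
    one is obtained by inserting a new last letter of row 1 together with an
    adjacent pair "row 2, row 3" after it, and [k], [S] become the number of
    letters after the last row-1 letter and the positions of the adjacent
    pairs "row 2, row 3" among these letters. The pair [(a, b)] describes the
    insertion on both sides and changes [k] and [S] in the same way, so
    permutations and tableaux are encoded by the same sequences of pairs. *)

Set Implicit Arguments.
Unset Strict Implicit.
Unset Printing Implicit Defensive.

(** * Insertion codes *)

(* The most recent insertion comes first. *)
Definition code := seq (nat * nat).

(* [top] and [asc] are [k] and [S] above, counted from 0: in a word, [top.+1]
   letters follow the last row-1 letter, and [asc] ignores a pair that follows
   this letter immediately. *)
Definition top (c : code) : nat := if c is (a, _) :: _ then a else 0.

Fixpoint asc (c : code) (z : nat) : bool :=
  if c is (a, b) :: c' then
    asc c' z && (z.+1 < b) || (z == b) && (b.+1 < a)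
  else false.

(** For permutations, [b < a] and [b <= top c'] give alternation, [a < (size c').*2.+2] keeps the
    letters in range, and the two other conditions forbid a 4123 that starts with [a], [b]. For
    words, [a <= (top c').+2] makes the inserted 0 the last one. *)
Fixpoint valid_code (c : code) : Prop :=
  if c is (a, b) :: c' then
    [/\ valid_code c', b < a <= (top c').+2, b <= top c', a < (size c').*2.+2
      & forall z, asc c' z -> z.+2 < a -> z < b]
  else True.

(** * Permutations built from codes *)

Definition ins_perm (a b : nat) (s : seq nat) : seq nat :=
  a :: b :: map (bump a \o bump b) s.

Fixpoint perm_of (c : code) : seq nat :=
  if c is (a, b) :: c' then ins_perm a b (perm_of c') else [::].

Definition alternating (s : seq nat) : Prop :=
  forall i, i.+1 < size s ->
    if odd i then nth 0 s i < nth 0 s i.+1 else nth 0 s i.+1 < nth 0 s i.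

Definition avoids (s : seq nat) : Prop :=
  forall x y z t, subseq [:: x; y; z; t] s -> ~ [/\ y < z, z < t & t < x].

Definition du4123 (n : nat) (s : seq nat) : Prop :=
  [/\ perm_eq s (iota 0 n.*2), alternating s & avoids s].

Lemma du4123_size n s : du4123 n s -> size s = n.*2.
Proof. by case=> /perm_size; rewrite size_iota. Qed.

Lemma du4123_uniq n s : du4123 n s -> uniq s.
Proof. by case=> /perm_uniq ->; rewrite iota_uniq. Qed.

Lemma du4123_mem n s x : du4123 n s -> (x \in s) = (x < n.*2).
Proof. by case=> /perm_mem ->; rewrite mem_iota. Qed.

Lemma bump2_inj a b : injective (bump a \o bump b).
Proof. by apply: inj_comp; apply: can_inj (@bumpK _). Qed.

Lemma bump2_mono a b x y : (bump a (bump b x) < bump a (bump b y)) = (x < y).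
Proof. by rewrite /bump; lia. Qed.

Lemma subseq_mapP (f : nat -> nat) (l s : seq nat) :
  subseq l (map f s) -> exists2 l', subseq l' s & l = map f l'.
Proof.
case/subseqP=> m sz ->; exists (mask m s); first exact: mask_subseq.
by rewrite map_mask.
Qed.

Lemma subseq_pairI (s : seq nat) x y : uniq s -> subseq [:: x; y] s ->
  [/\ x \in s, y \in s, x != y & y != head 0 s].
Proof.
move=> us sub; have := mem_subseq sub; move=> H.
have ux := subseq_uniq sub us.
have xs : x \in s by apply: H; rewrite !inE eqxx.
have ys : y \in s by apply: H; rewrite !inE eqxx orbT.
split=> //; first by move: ux; rewrite /= inE andbT.
case: s us sub {H ux xs ys} => [|h s] //= /andP[hs us].
case: eqP => [_|_] sub; apply: contraNneq hs => e; have := mem_subseq sub;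
  by apply; rewrite !inE e eqxx ?orbT.
Qed.

Lemma subseq_head (s l : seq nat) : head 0 s \notin l -> l != [::] ->
  subseq l s -> subseq (head 0 s :: l) s.
Proof.
case: s => [|h s]; first by case: l.
by case: l => [|x l] //=; rewrite inE negb_or eq_sym eqxx => /andP[/negbTE -> _].
Qed.

(** As [b < a], the map [bump a \o bump b] sends the old range onto the new one with [a] and [b]
    left out. *)
Lemma perm_ins n a b s : b < a < n.*2.+2 ->
  perm_eq (ins_perm a b s) (iota 0 n.+1.*2) = perm_eq s (iota 0 n.*2).
Proof.
move=> /andP[ba an].
have E : perm_eq (iota 0 n.+1.*2) (ins_perm a b (iota 0 n.*2)).
  apply: uniq_perm; first exact: iota_uniq.
    rewrite /= inE negb_or map_inj_uniq ?iota_uniq ?andbT; last exact: bump2_inj.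
    rewrite -andbA; apply/and3P; split; first by lia.
      by apply/mapP => -[x _]; rewrite /= /bump; lia.
    by apply/mapP => -[x _]; rewrite /= /bump; lia.
  move=> x; rewrite mem_iota !inE add0n leq0n /=; apply/idP/idP => [xn|].
    case: eqP => //= xa; case: eqP => //= xb; apply/mapP.
    by exists (unbump b (unbump a x)); rewrite ?mem_iota /= /bump /unbump; lia.
  case/or3P=> [/eqP ->|/eqP ->|/mapP[y]]; try lia.
  by rewrite mem_iota /= /bump => ? ->; lia.
rewrite (permPr E) /ins_perm !perm_cons.
by apply/idP/idP; [apply: perm_map_inj; apply: bump2_inj|apply: perm_map].
Qed.

Lemma alternating_ins a b s : b < a -> (s = [::] \/ b <= head 0 s) ->
  alternating s -> alternating (ins_perm a b s).
Proof.
move=> ba hd alt [|[|i]] //= lt_i.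
  by case: s hd lt_i {alt} => [|h s] //= [] // bh _; rewrite /bump; lia.
rewrite size_map in lt_i; rewrite !negbK.
by rewrite !(nth_map 0) /= ?bump2_mono; try lia; apply: alt.
Qed.

Lemma ins_alternating a b s : alternating (ins_perm a b s) ->
  [/\ b < a, s = [::] \/ b <= head 0 s & alternating s].
Proof.
move=> alt; split; first exact: (alt 0).
  case: s alt => [|h s] alt; [by left | right].
  by have := alt 1 isT; rewrite /= /bump; lia.
move=> i lt_i; have := alt i.+2; rewrite /= size_map !negbK => /(_ lt_i).
by rewrite !(nth_map 0) /= ?bump2_mono; lia.
Qed.

Lemma avoids_subseq s1 s2 : subseq s1 s2 -> avoids s2 -> avoids s1.
Proof. by move=> sub av x y z t /subseq_trans/(_ sub); apply: av. Qed.

Lemma avoids_map a b s : avoids (map (bump a \o bump b) s) <-> avoids s.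
Proof.
split=> av x y z t sub.
  have := @av (bump a (bump b x)) (bump a (bump b y)) (bump a (bump b z))
              (bump a (bump b t)) (map_subseq _ sub).
  by rewrite !bump2_mono.
case/subseq_mapP: sub => -[|x' [|y' [|z' [|t' []]]]] // sub [-> -> -> ->] /=.
by rewrite !bump2_mono; apply: av.
Qed.

(** The last two clauses make [asc] a faithful record: every ascent below the first letter spans a
    recorded one, and recorded ones do occur. The induction needs both to control the next
    insertion. *)
Lemma perm_of_sound c : valid_code c ->
  [/\ du4123 (size c) (perm_of c), head 0 (perm_of c) = top c,
      forall x y, subseq [:: x; y] (perm_of c) -> x < y < top c ->
        exists2 z, asc c z & x <= z < y
    & forall z, asc c z -> subseq [:: z; z.+1] (perm_of c) /\ z.+1 < top c].
Proof.
elim: c => [|[a b] c IH]; first by split=> //; split=> // x y z t; case: x.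
case=> vc /andP[ba ak] bk an Sab; have [D hd I4 I5] := IH vc.
set s := perm_of c in D hd I4 I5 *.
have us := du4123_uniq D.
(* [y] is not the first letter [top c], and [a.-1 <= (top c).+1]. *)
have below x y : subseq [:: x; y] s -> y < a.-1 -> y < top c.
  by move=> /(subseq_pairI us)[_ _ _]; rewrite hd; lia.
have bumpa y : (bump a (bump b y) < a) -> y < a.-1 by rewrite /bump; lia.
(* Such a triple would complete a 4123 in [s] with the first letter [top c]. *)
have no123 x y z : subseq [:: x; y; z] s -> x < y -> y < z -> z < a.-1 -> False.
  move=> sub xy yz za; case: D => _ _ av.
  have zk : z < top c.
    by apply: (below y) => //; apply: subseq_trans (subseq_cons _ _) sub.
  apply: (av (top c) x y z) => //; rewrite -hd; apply: subseq_head => //.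
  by rewrite hd !inE; lia.
split=> //=.
- have [P alt av] := D; split; first by rewrite perm_ins // ba an.
    by apply: alternating_ins; rewrite ?hd //; right.
  move=> x y z t; rewrite [subseq _ _]/=.
  case: (x =P a) => [-> | xa].
    case: (y =P b) => [-> | yb].
      case/subseq_mapP => -[|z' [|t' []]] // sub [-> ->] /= [lt1 lt2 lt3].
      have t'a := bumpa _ lt3; rewrite bump2_mono in lt2.
      have t'k := below _ _ sub t'a.
      (* The ascent from [z'] to [t'] spans a recorded [w]; validity forces [w < b], while
         [b <= z' <= w]. *)
      have [|w Sw /andP[zw wt]] := I4 _ _ sub; first by rewrite lt2.
      have := Sab w Sw; move: lt1; rewrite /bump; lia.
    case/subseq_mapP => -[|y' [|z' [|t' []]]] // sub [-> -> ->] /= [].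
    by rewrite !bump2_mono => lt1 lt2 /bumpa; apply: no123 sub lt1 lt2.
  case: (x =P b) => [-> | xb].
    case/subseq_mapP => -[|y' [|z' [|t' []]]] // sub [-> -> ->] /= [].
    rewrite !bump2_mono => lt1 lt2 lt3.
    by apply: no123 sub lt1 lt2 _; apply: bumpa; lia.
  by move=> sub; move/(avoids_map a b): av; apply.
- move=> x y; case: (x =P a) => [->|xa]; first by lia.
  case: (x =P b) => [-> _ yb|xb].
    by exists b; [rewrite eqxx; apply/orP; right; lia | lia].
  case/subseq_mapP => -[|x' [|y' []]] // sub [-> ->] /=.
  rewrite bump2_mono => /andP[lt1 /bumpa lt2].
  have [|z Sz /andP[xz zy]] := I4 _ _ sub; first by rewrite lt1 (below _ _ sub).
  (* If [z] is not kept, validity leaves only [z.+1 = b]. Then [x' < b <= y'], so the new ascent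
     from [b] to [b.+1] lies in the required interval. *)
  have zb := Sab z Sz; have [zb'|zb'] := ltnP z.+1 b.
    by exists z; [rewrite Sz zb' | rewrite /bump; lia].
  by exists b; [rewrite eqxx; apply/orP; right; lia | rewrite /bump; lia].
move=> z /orP[/andP[Sz zb]|/andP[/eqP -> ba2]].
  have [sub _] := I5 z Sz; split; last by lia.
  change (subseq [:: z; z.+1] ([:: a; b] ++ map (bump a \o bump b) s)).
  have -> : [:: z; z.+1] = map (bump a \o bump b) [:: z; z.+1].
    by rewrite /= /bump; congr [:: _; _]; lia.
  exact: subseq_trans (map_subseq _ sub) (suffix_subseq _ _).
split=> //; have ->: (b == a) = false by lia.
rewrite eqxx sub1seq; apply/mapP; exists b; last by rewrite /= /bump; lia.
by rewrite (du4123_mem _ D); lia.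
Qed.

(** Deleting the first two letters and closing the gaps undoes [ins_perm]; the validity of the
    deleted pair is read off from alternation and avoidance. *)
Lemma perm_of_complete n s : du4123 n s ->
  exists2 c, valid_code c & size c = n /\ perm_of c = s.
Proof.
elim: n s => [|n IH] s D; have := du4123_size D.
  by move/size0nil->; exists [::].
case: s D => [|a [|b s'']] // D _.
have us := du4123_uniq D.
have an : a < n.+1.*2 by rewrite -(du4123_mem a D) !inE eqxx.
have bn : b < n.+1.*2 by rewrite -(du4123_mem b D) !inE eqxx orbT.
have ba : b < a by case: D => _ /(_ 0 isT).
pose s := map (unbump b \o unbump a) s''.
have Es : s'' = map (bump a \o bump b) s.
  rewrite /s -map_comp -[LHS]map_id; apply/eq_in_map => x xs /=.
  move: us; rewrite /= inE negb_or => /and3P[/andP[_ na] nb _].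
  have xa : x != a by apply: contraNneq na => <-.
  have xb : x != b by apply: contraNneq nb => <-.
  by move: xa xb; rewrite /bump /unbump; lia.
have [P alt av] := D.
have {}D : du4123 n s.
  split; first by move: P; rewrite Es perm_ins // ba.
    by move: alt; rewrite Es => /ins_alternating[].
  by apply/(avoids_map a b); rewrite -Es; apply: avoids_subseq av;
    exact: (suffix_subseq [:: a; b]).
have [c vc [sc Ec]] := IH s D.
have [_ hd I4 I5] := perm_of_sound vc; rewrite Ec in hd I4 I5.
exists ((a, b) :: c); last by rewrite /= sc Ec /ins_perm -Es.
(* After the shift both letters lie strictly between [b] and [a], so [a], [b] and they form a
   4123. *)
have no12 x y : subseq [:: x; y] s -> b <= x -> x < y -> y < a.-1 -> False.
  move=> sub bx xy ya.
  apply: (av a b (bump a (bump b x)) (bump a (bump b y))).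
    by rewrite /= !eqxx Es; apply: (map_subseq _ sub).
  by split; rewrite ?bump2_mono // /bump; lia.
have bk : b <= top c.
  move: alt; rewrite Es => /ins_alternating[_ [s0|]]; last by rewrite hd.
  by have := du4123_size D; rewrite s0 /=; lia.
split=> //; last first.
- move=> z Sz za; rewrite ltnNge; apply/negP => bz.
  by have [sub _] := I5 z Sz; apply: no12 sub bz _ _; lia.
- by rewrite sc; lia.
(* For larger [a], the first letter [top c] and its successor, which comes later, would be such an
   ascent. *)
rewrite ba /= leqNgt; apply/negP => ka.
apply: (no12 (top c) (top c).+1) => //; last by lia.
rewrite -hd; apply: subseq_head => //; first by rewrite hd inE; lia.
by rewrite sub1seq hd (du4123_mem _ D); lia.
Qed.

Lemma perm_of_inj : injective perm_of.
Proof.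
elim=> [|[a b] c IH] [|[a' b'] c'] //= [<- <-].
by move/(inj_map (@bump2_inj a b))/IH->.
Qed.

(** * Yamanouchi words *)

(* Words are reversed (last letter first), and the rows are numbered 0, 1, 2:
   the pair is inserted before the [b] last letters of the word, the new
   letter 0 before what are then the [a.+1] last letters. *)
Definition ins_word (a b : nat) (w : seq nat) : seq nat :=
  take b w ++ [:: 2; 1] ++ drop b (take a.-1 w) ++ 0 :: drop a.-1 w.

Fixpoint word_of (c : code) : seq nat :=
  if c is (a, b) :: c' then ins_word a b (word_of c') else [::].

Definition cnt (h : nat) (w : seq nat) : nat := count_mem h w.
Arguments cnt : simpl never.

Lemma cnt_cons h x w : cnt h (x :: w) = (x == h) + cnt h w.
Proof. by []. Qed.

Lemma cnt_cat h w1 w2 : cnt h (w1 ++ w2) = cnt h w1 + cnt h w2.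
Proof. exact: count_cat. Qed.

(** The tail [w'] consists of the letters read before [h], so this is the lattice word condition on
    reading prefixes. *)
Fixpoint ballot (w : seq nat) : bool :=
  if w is h :: w' then
    [&& ballot w', h < 3 & (h == 0) || (cnt h w' < cnt h.-1 w')]
  else true.

Definition yamanouchi (n : nat) (w : seq nat) : Prop :=
  ballot w /\ forall h, h < 3 -> cnt h w = n.

Lemma ballot_lt3 w : ballot w -> all (gtn 3) w.
Proof. by elim: w => //= h w IH /and3P[/IH -> ->]. Qed.

Lemma size_count3 w : all (gtn 3) w ->
  size w = cnt 0 w + cnt 1 w + cnt 2 w.
Proof. by elim: w => //= -[|[|[|h]]] w IH //= /IH ->; rewrite !cnt_cons; lia. Qed.

Lemma yamanouchi_size n w : yamanouchi n w -> size w = 3 * n.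
Proof. by case=> /ballot_lt3/size_count3 -> cn; rewrite !cn //; lia. Qed.

Lemma ballot_count w : ballot w ->
  cnt 2 w <= cnt 1 w <= cnt 0 w.
Proof. by elim: w => //= -[|[|[|h]]] w IH //= /andP[/IH]; rewrite !cnt_cons; lia. Qed.

Lemma ballot_catr y w : ballot (y ++ w) -> ballot w.
Proof. by elim: y => //= h y IH /andP[/IH]. Qed.

(* Raising all three letter counts of a suffix by one keeps every ballot
   inequality further on. *)
Lemma ballot_cat_shift (y A B : seq nat) :
  (forall h, h < 3 -> cnt h A = (cnt h B).+1) ->
  ballot A -> ballot B -> ballot (y ++ A) = ballot (y ++ B).
Proof.
move=> cAB bA bB; elim: y => /= [|h y ->]; first by rewrite bA bB.
by case: h => [|[|[|h]]] //=; rewrite ?andbF // !cnt_cat !cAB ?addnS.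
Qed.

(** Along [x] the number of 0s is constant and that of 1s can only grow, so the inequality for all
    of [x ++ p] implies the one at each intermediate stage. *)
Lemma ballot_ins0 (x p : seq nat) : 0 \notin x -> ballot (x ++ 0 :: p) ->
  cnt 1 (x ++ p) <= cnt 0 (x ++ p) -> ballot (x ++ p).
Proof.
elim: x => [|h x IH] /=; first by move=> _ /andP[].
rewrite inE negb_or !cnt_cons => /andP[h0 x0] /and3P[b1 h3 b2] cc.
rewrite IH //=; last by lia.
move: h0 h3 b2 cc; case: h => [|[|[|h]]] //= _ _; rewrite !cnt_cat !cnt_cons /=; lia.
Qed.

(** An additional 0 leaves room for exactly one more 1, and this 1 for one more 2. Conversely, the
    legality of the inserted 1 is the inequality needed to remove the 0. *)
Lemma ballot_ins (x p : seq nat) : 0 \notin x ->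
  ballot [:: 2, 1 & x ++ 0 :: p] = ballot (x ++ p).
Proof.
move=> x0; have c0 : cnt 0 x = 0 by apply/count_memPn.
rewrite /= !(cnt_cat, cnt_cons) /= !c0; apply/idP/idP.
  case/andP=> /andP[b c1] _; apply: ballot_ins0 => //.
  by rewrite !cnt_cat c0; lia.
move=> b; have := ballot_count b; rewrite !cnt_cat c0 => cc.
have -> : ballot (x ++ 0 :: p); last by lia.
elim: x x0 b {c0 cc} => /= [|h x IH]; first by move=> _ ->.
rewrite inE negb_or => /andP[h0 x0] /and3P[/(IH x0) -> ->] /=.
by rewrite !cnt_cat !cnt_cons; case: h h0 => [|[|h]] //=; lia.
Qed.

(** The three new letters precede those of [y] in reading order and raise every count by one, so the
    conditions along [y] do not change. *)
Lemma yamanouchi_ins n (y x p : seq nat) : 0 \notin x ->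
  yamanouchi n.+1 (y ++ [:: 2, 1 & x ++ 0 :: p]) <-> yamanouchi n (y ++ x ++ p).
Proof.
move=> x0.
have cc h : h < 3 -> cnt h [:: 2, 1 & x ++ 0 :: p] = (cnt h (x ++ p)).+1.
  by case: h => [|[|[|h]]] // _; rewrite !(cnt_cat, cnt_cons) /=; lia.
have cc2 h : h < 3 -> cnt h (y ++ [:: 2, 1 & x ++ 0 :: p]) =
    (cnt h (y ++ x ++ p)).+1.
  by move=> h3; rewrite cnt_cat cc // addnS -cnt_cat.
split=> -[b cn]; split.
- have bA := ballot_catr b; have bB := bA; rewrite ballot_ins // in bB.
  by rewrite -(ballot_cat_shift _ cc).
- by move=> h h3; apply: succn_inj; rewrite -cc2 // cn.
- have bB := ballot_catr b; have bA := bB; rewrite -ballot_ins // in bA.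
  by rewrite (ballot_cat_shift _ cc).
by move=> h h3; rewrite cc2 // cn.
Qed.

(** * Words built from codes *)

Lemma ins_word_cat (y x p : seq nat) :
  ins_word (size y + size x).+1 (size y) (y ++ x ++ p) =
  y ++ [:: 2, 1 & x ++ 0 :: p].
Proof.
rewrite /ins_word /= take_size_cat // catA -size_cat take_size_cat //.
by rewrite !drop_size_cat // -catA.
Qed.

Lemma ins_wordP a b (w : seq nat) : b < a -> a.-1 <= size w -> exists y x p : seq nat,
  [/\ w = y ++ x ++ p, size y = b, (size y + size x).+1 = a &
    ins_word a b w = y ++ [:: 2, 1 & x ++ 0 :: p]].
Proof.
move=> ba aw; exists (take b w), (drop b (take a.-1 w)), (drop a.-1 w).
have sy : size (take b w) = b by rewrite size_takel //; lia.
have tt : take b w = take b (take a.-1 w) by rewrite take_takel //; lia.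
split=> //.
- by rewrite catA tt !cat_take_drop.
- by rewrite sy size_drop size_takel //; lia.
Qed.

Lemma nth_ins_word a b w i : b < a -> a.-1 <= size w ->
  nth 0 (ins_word a b w) i =
  if i < b then nth 0 w i else if i == b then 2 else if i == b.+1 then 1
  else if i <= a then nth 0 w (i - 2) else if i == a.+1 then 0
  else nth 0 w (i - 3).
Proof.
move=> ba aw; have [y [x [p [-> <- <- ->]]]] := ins_wordP ba aw.
rewrite !nth_cat; case: ltnP => // yi.
have -> : i = size y + (i - size y) by lia.
move: (i - size y) => {yi}j; rewrite addKn.
case: j => [|[|j]] /=; rewrite ?addn0 ?addn1 ?eqxx //.
  by rewrite ifF //; lia.
have [-> ->] : (size y + j.+2 == size y) = false /\ (size y + j.+2 == (size y).+1) = false by lia.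
rewrite nth_cat; case: ltnP => jx.
  rewrite ifT; last by lia.
  rewrite ifF; last by lia.
  by rewrite ifT; [congr nth|]; lia.
rewrite ifF; last by lia.
have -> : j = size x + (j - size x) by lia.
move: (j - size x) => {jx}j; rewrite addKn.
case: j => [|j] /=; first by rewrite ifT //; lia.
by rewrite !ifF; [congr nth|..]; lia.
Qed.

(** The second and third clauses locate the last 0 at index [(top c).+1]; for the empty code the
    third one holds by the default value of [nth]. *)
Lemma word_of_sound c : valid_code c ->
  [/\ yamanouchi (size c) (word_of c),
      forall i, i <= top c -> i < size (word_of c) -> nth 0 (word_of c) i != 0,
      nth 0 (word_of c) (top c).+1 = 0
    & forall z, asc c z = [&& z.+1 < top c, nth 0 (word_of c) z == 2
                            & nth 0 (word_of c) z.+1 == 1]].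
Proof.
elim: c => [|[a b] c IH].
  by [].
case=> vc /andP[ba ak] bk an Sab; have [Y I1 I2 I3] := IH vc.
have sw := yamanouchi_size Y; rewrite [top _]/= [word_of _]/= [size _]/=.
set w := word_of c in Y I1 I2 I3 sw *.
have aw : a.-1 <= size w by lia.
have nthE := nth_ins_word _ ba aw.
split.
- have [y [x [p [Ew Ey Ex ->]]]] := ins_wordP ba aw.
  apply/yamanouchi_ins; last by rewrite -Ew.
  apply/(nthP 0) => -[j /= jx xj0].
  have E : nth 0 w (size y + j) = 0.
    by rewrite Ew nth_cat ifF ?addKn ?nth_cat ?jx //; lia.
  have := I1 (size y + j); rewrite E Ew !size_cat => H.
  by have: 0 != 0 by apply: H; lia.
- move=> i ia _; rewrite nthE; case: ltnP => ib; first by apply: I1; lia.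
  case: (i =P b) => // nb; case: (i =P b.+1) => // nb1.
  by rewrite ia; apply: I1; lia.
- by rewrite nthE; do 4!(rewrite ifF; last by lia); rewrite eqxx.
move=> z; rewrite [LHS]/= !nthE I3.
have [zb|bz] := ltnP z.+1 b.
  by rewrite ifT; lia.
have [->|nzb] := eqVneq z b.
  have -> : (b.+1 == b) = false by lia.
  by rewrite ltnn !eqxx andbF !andbT.
rewrite andbF /=; apply/esym/negP; case/and3P=> za.
have [zb|zb] := ltnP z b; first by have -> : z.+1 == b by lia.
case: (z =P b.+1) => // nzb1.
have [-> -> -> ->] : [/\ (z.+1 == b) = false, (z.+1 == b.+1) = false,
    (z <= a) = true & (z < a) = true] by split; lia.
(* Such a pair comes from an old one at [z - 2 >= b], against the last validity condition. *)
move=> w1 w2; have := Sab (z - 2); rewrite I3 w1.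
by rewrite (_ : (z-2).+1 = z.+1 - 2) ?w2; lia.
Qed.

Lemma valid_top c : valid_code c -> top c <= (size c).*2.-1.
Proof. by case: c => [|[a b] c] //= []; lia. Qed.

Lemma ins_word_inj a b w1 w2 : b < a -> a.-1 <= size w1 ->
  size w1 = size w2 -> ins_word a b w1 = ins_word a b w2 -> w1 = w2.
Proof.
move=> ba aw1 sw E; have aw2 : a.-1 <= size w2 by rewrite -sw.
apply: (@eq_from_nth _ 0) => // i _.
have [ib|ib] := ltnP i b.
  by have := congr1 (fun s => nth 0 s i) E; rewrite !nth_ins_word // ib.
have [ia|ia] := ltnP i.+1 a.
  have := congr1 (fun s => nth 0 s i.+2) E; rewrite !nth_ins_word //.
  have [-> -> -> ->] : [/\ (i.+2 < b) = false, (i.+2 == b) = false,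
    (i.+2 == b.+1) = false & (i.+2 <= a) = true] by split; lia.
  by rewrite subn2.
have := congr1 (fun s => nth 0 s i.+3) E; rewrite !nth_ins_word //.
do 5!(rewrite ifF; last by lia); do 5!(rewrite ifF; last by lia).
by rewrite subSS subSS subSS subn0.
Qed.

(** The pair inserted at [b2] is seen in the first word as an old pair at [b2 - 2], shifted by two.
    It is recorded by [asc c1] and lies beyond [b1], which validity excludes. *)
Lemma ins_word_ltF a b1 b2 c1 c2 :
  valid_code ((a, b1) :: c1) -> valid_code ((a, b2) :: c2) -> size c1 = size c2 ->
  ins_word a b1 (word_of c1) = ins_word a b2 (word_of c2) -> b1 < b2 -> False.
Proof.
move=> [v1 /andP[ba1 ak1] bk1 an1 S1] [v2 /andP[ba2 ak2] bk2 an2 S2] sc E b12.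
have [Y1 N1 Z1 T1] := word_of_sound v1; have [Y2 N2 Z2 T2] := word_of_sound v2.
have s1 := yamanouchi_size Y1; have s2 := yamanouchi_size Y2.
have aw1 : a.-1 <= size (word_of c1) by lia.
have aw2 : a.-1 <= size (word_of c2) by lia.
have nthE i := congr1 (fun s => nth 0 s i) E.
have := nthE b1.+1; rewrite !nth_ins_word // ltnNge leqnSn /= eqxx.
rewrite (_ : (b1.+1 == b1) = false); last by lia.
have [lt|le] := ltnP b1.+1 b2; last by case: eqP => //; lia.
move=> _; have := nthE b2; rewrite !nth_ins_word //.
do 3!(rewrite ifF; last by lia); rewrite ifT; last by lia.
rewrite ltnn eqxx => w1; have := nthE b2.+1; rewrite !nth_ins_word //.
do 3!(rewrite ifF; last by lia); rewrite ifT; last by lia.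
do 2!(rewrite ifF; last by lia); rewrite eqxx => w2.
(* Otherwise [a.-1 = b2 = (top c1).+1], where the first old word has a 0; the second has none there
   because [b2 <= top c2]. *)
have b2k : b2 <= top c1.
  rewrite leqNgt; apply/negP => lt2.
  have := nthE a.+2; rewrite !nth_ins_word //.
  do 5!(rewrite ifF; last by lia); do 5!(rewrite ifF; last by lia).
  rewrite (_ : a.+2 - 3 = (top c1).+1) ?Z1; last by lia.
  by move/esym/eqP; apply/negP/N2; lia.
have := S1 (b2 - 2); rewrite T1 w1.
by rewrite (_ : (b2 - 2).+1 = b2.+1 - 2) ?w2; lia.
Qed.

Lemma word_of_inj c1 c2 : valid_code c1 -> valid_code c2 -> size c1 = size c2 ->
  word_of c1 = word_of c2 -> c1 = c2.
Proof.
elim: c1 c2 => [|[a1 b1] c1 IH] [|[a2 b2] c2] // v1 v2 [sc] E.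
(* The index of the last 0 in reading order determines [a]. *)
have ea : a1 = a2.
  have [Y1 N1 Z1 _] := word_of_sound v1; have [Y2 N2 Z2 _] := word_of_sound v2.
  have s1 := yamanouchi_size Y1; have t1 := valid_top v1; have t2 := valid_top v2.
  rewrite -E in N2 Z2; rewrite /= in t1 t2 s1.
  rewrite [top _]/= in N1 Z1; rewrite [top _]/= in N2 Z2.
  have [lt|lt|//] := ltngtP a1 a2.
    by have := N2 a1.+1 lt; rewrite Z1 s1 => /(_ _)/eqP []; lia.
  by have := N1 a2.+1 lt; rewrite Z2 s1 => /(_ _)/eqP []; lia.
subst a2; have [v1' v2'] := (v1, v2); case: v1 v2 => v1 /andP[ba1 ak1] bk1 an1 S1 [v2 /andP[ba2 ak2] bk2 an2 S2].
rewrite [LHS]/= [RHS]/= in E.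
have [[Y1 _ _ _] [Y2 _ _ _]] := (word_of_sound v1, word_of_sound v2).
have s1 := yamanouchi_size Y1; have s2 := yamanouchi_size Y2.
have eb : b1 = b2.
  have [lt|lt|//] := ltngtP b1 b2.
    by have := ins_word_ltF v1' v2' sc E lt.
  by have := ins_word_ltF v2' v1' (esym sc) (esym E) lt.
subst b2; congr (_ :: _); apply: IH => //.
by apply: ins_word_inj E => //; rewrite s1 ?s2 ?sc //; lia.
Qed.

(** Removing a final 0 or 1 would leave more 1s than 0s or more 2s than 1s. *)
Lemma yamanouchi_head n w : yamanouchi n.+1 w -> nth 0 w 0 = 2.
Proof.
case: w => [|h w] [b cn]; first by have := cn 0 isT.
case/and3P: b => /ballot_count cc h3 _.
have := cn 0 isT; have := cn 1 isT; have := cn 2 isT; rewrite !cnt_cons.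
by move=> {cn}; case: h h3 => [|[|[|h]]] //= _; lia.
Qed.

Lemma cnt_mem h w : (0 < cnt h w) = (h \in w).
Proof. by rewrite /cnt -has_count has_pred1. Qed.

(** Here [t] holds the letters read after the last 0 and [p] those before it. Remove this 0 and the
    earliest admissible pair in [t], that is, the one of largest index; maximality gives the last
    validity condition. *)
Lemma word_of_complete n w : yamanouchi n w ->
  exists2 c, valid_code c & size c = n /\ word_of c = w.
Proof.
elim: n w => [|n IH] w Y.
  by have := yamanouchi_size Y; rewrite muln0 => /size0nil ->; exists [::].
have [b cn] := Y.
have w0 : 0 \in w by rewrite -cnt_mem cn.
pose t := take (index 0 w) w; pose p := drop (index 0 w).+1 w.
have Ew : w = t ++ 0 :: p.
  by rewrite -{1}(cat_take_drop (index 0 w) w) (drop_nth 0) ?index_mem // nth_index.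
have t0 : 0 \notin t.
  by rewrite /t -[w in take _ w]/w; apply/negP => /index_ltn; rewrite ltnn.
have lt3 : all (gtn 3) t.
  by have := ballot_lt3 b; rewrite Ew all_cat => /andP[].
have ct0 : cnt 0 t = 0 by apply/count_memPn.
have [ct1 ct2] : cnt 1 t <= n.+1 /\ cnt 2 t <= n.+1.
  by have := cn 1 isT; have := cn 2 isT; rewrite Ew !cnt_cat !cnt_cons /=; lia.
have st : size t <= n.+1.*2 by rewrite (size_count3 lt3); lia.
have bp : ballot p.
  by have /andP[] : ballot (0 :: p) by apply: (@ballot_catr t); rewrite -Ew.
have wt i : i < size t -> nth 0 w i = nth 0 t i by move=> it; rewrite Ew nth_cat it.
have tn0 i : i < size t -> nth 0 t i != 0.
  by move=> it; apply: contraNneq t0 => <-; apply: mem_nth.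
(* When another 0 directly precedes the last one, a pair adjacent to the last 0 is excluded:
   removing it would violate [b <= top c]. The default 1 imposes nothing when [p] is empty. *)
pose Q z := [&& nth 0 w z == 2, nth 0 w z.+1 == 1, z.+1 < size t
              & (head 1 p == 0) ==> (z.+2 < size t)].
(* Take the 1 of least index in [t]: its neighbour of smaller index exists and is neither 0 nor 1.
   If [p] starts with 0, counting gives a second 1 in [t], so the pair does not reach the end of
   [t]. *)
have exQ : exists z, Q z.
  have c1p : cnt 1 p <= cnt 0 p by have := ballot_count bp; lia.
  have [cn0 cn1] := (cn 0 isT, cn 1 isT).
  rewrite Ew !cnt_cat !cnt_cons /= in cn0 cn1.
  have t1 : 1 \in t by rewrite -cnt_mem; lia.
  have it : index 1 t < size t by rewrite index_mem.
  have ni : nth 0 t (index 1 t) = 1 by exact: nth_index.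
  have i0 : 0 < index 1 t.
    rewrite lt0n; apply/eqP => i0; rewrite i0 in ni it.
    by have := yamanouchi_head Y; rewrite wt // ni.
  have it' : (index 1 t).-1 < size t by lia.
  exists (index 1 t).-1; rewrite /Q prednK // (wt _ it) (wt _ it') ni it /=.
  apply/andP; split.
    have: nth 0 t (index 1 t).-1 < 3.
      by have /all_nthP := lt3; apply; lia.
    have := tn0 (index 1 t).-1; have: nth 0 t (index 1 t).-1 != 1.
      apply/negP => e1; have := @before_find _ 0 (pred1 1) t (index 1 t).-1.
      by rewrite -/(index 1 t) prednK // leqnn /= e1 => /(_ isT).
    lia.
  apply/implyP => /eqP hp.
  have : 1 < cnt 1 t.
    case: (p) hp bp cn0 cn1 => [|h p'] //= -> /andP[/ballot_count].
    by rewrite !cnt_cons /=; lia.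
  rewrite -[t in cnt 1 t](cat_take_drop (index 1 t)) (drop_nth 0) // ni.
  have c1 : cnt 1 (take (index 1 t) t) = 0.
    by apply/count_memPn/negP => /index_ltn; rewrite ltnn.
  rewrite cnt_cat c1 cnt_cons => H; rewrite ltnNge; apply/negP => le.
  by rewrite drop_oversize // in H.
case: (ex_maxnP exQ (m := size t)) => [z /and4P[_ _]|z]; first by lia.
case/and4P=> /eqP wz /eqP wz1 zt spec maxz.
pose y := take z t; pose x := drop z.+2 t.
have Et : t = y ++ [:: 2, 1 & x].
  rewrite -{1}(cat_take_drop z t) (drop_nth 0) ?(drop_nth 0 (n := z.+1)) //; last by lia.
  by rewrite -!wt ?wz ?wz1 //; lia.
have sy : size y = z by rewrite size_takel //; lia.
have sx : (size y + size x).+2 = size t by rewrite Et size_cat /=; lia.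
have x0 : 0 \notin x by apply: contra t0 => H; rewrite Et mem_cat !inE H !orbT.
have Ew' : w = y ++ [:: 2, 1 & x ++ 0 :: p] by rewrite Ew Et -catA.
have Yw : yamanouchi n (y ++ x ++ p) by apply/yamanouchi_ins; rewrite // -Ew'.
have [c vc [sc Ec]] := IH _ Yw.
pose a := (size t).-1.
have EW : w = ins_word a z (y ++ x ++ p).
  by rewrite Ew' -ins_word_cat sy; congr ins_word; lia.
exists ((a, z) :: c); last first.
  by rewrite /= sc Ec -EW.
have [_ N0 Z0 T0] := word_of_sound vc; rewrite Ec in N0 Z0 T0.
have sw := yamanouchi_size Yw; have tc := valid_top vc; rewrite sc in tc.
have Ea : a.+1 = size t by rewrite /a; lia.
have za : z < a by lia.
have aw : a.-1 <= size (y ++ x ++ p) by rewrite !size_cat; lia.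
have nthE i := nth_ins_word i za aw; rewrite -EW in nthE.
have wn0 j : j < a.-1 -> nth 0 (y ++ x ++ p) j != 0.
  move=> ja; have jy : j < size (y ++ x) by rewrite size_cat; lia.
  rewrite catA nth_cat jy; apply: contraNneq t0 => E; rewrite -{}E.
  have: nth 0 (y ++ x) j \in y ++ x by apply: mem_nth.
  by rewrite Et !mem_cat !inE => /orP[] ->; rewrite ?orbT.
have wa : nth 0 (y ++ x ++ p) a.-1 = nth 0 p 0.
  rewrite catA nth_cat ifF; last by rewrite size_cat; lia.
  by congr nth; rewrite size_cat; lia.
have ak : a <= (top c).+2.
  rewrite leqNgt; apply/negP => lt.
  by have := wn0 (top c).+1; rewrite Z0 => /(_ _)/eqP []; lia.
split=> //.
- by rewrite za.
(* Otherwise [z = (top c).+1 = a.-1], so [p] starts with 0 and the chosen pair is the one excluded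
   by [Q]. *)
- rewrite leqNgt; apply/negP => lt.
  have [n0|n0] := posnP n; first by lia.
  have hp : head 1 p = 0.
    move: wa; rewrite (_ : a.-1 = (top c).+1) ?Z0; last by lia.
    by case: (p) sw => [|h p'] //=; rewrite cats0 size_cat; lia.
  by move: spec; rewrite hp /=; lia.
- by rewrite sc; lia.
move=> u; rewrite T0 => /and3P[uk /eqP u2 /eqP u1] ua.
rewrite ltnNge; apply/negP => zu.
(* The old pair at [u] sits at [u.+2] in [w], which would contradict the maximality of [z]. *)
have: Q u.+2.
  rewrite /Q !nthE; do 3!(rewrite ifF; last by lia); rewrite ifT; last by lia.
  do 3!(rewrite ifF; last by lia); rewrite ifT; last by lia.
  rewrite subn2 u2 (_ : u.+3 - 2 = u.+1) ?u1 ?eqxx /=; last by lia.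
  apply/andP; split; first by lia.
  apply/implyP => /eqP hp; have := N0 a.-1; rewrite wa.
  have -> : nth 0 p 0 = 0 by case: (p) hp.
  have [le|] := leqP a.-1 (top c); last by lia.
  move/(_ isT); rewrite sw => /(_ _)/eqP []; lia.
by move/maxz; lia.
Qed.

(** * Tableaux *)

Definition row_of n (T : 'M[nat]_(3, n)) (v : nat) : nat :=
  if [pick x : 'I_3 * 'I_n | T x.1 x.2 == v] is Some x then val x.1 else 0.

(** The row of the largest value comes first, as in the reversed words above. *)
Fixpoint row_word n (T : 'M[nat]_(3, n)) (v : nat) : seq nat :=
  if v is v'.+1 then row_of T v :: row_word T v' else [::].

Definition row_count n (T : 'M[nat]_(3, n)) (r : 'I_3) (v : nat) : nat :=
  #|[set j | T r j <= v]|.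

Section Tableaux.
Variables (n : nat) (T : 'M[nat]_(3, n)).
Hypothesis TP : is_rect_SYT T.

Let values := [seq T x.1 x.2 | x : 'I_3 * 'I_n].

Lemma syt_mem x : T x.1 x.2 \in values.
Proof. exact: image_f. Qed.

Lemma syt_bound r j : 0 < T r j <= 3 * n.
Proof.
case/and3P: TP => /perm_mem P _ _.
by have := syt_mem (r, j); rewrite P mem_iota /=; lia.
Qed.

Lemma syt_onto v : 0 < v <= 3 * n -> exists r j, T r j = v.
Proof.
case/and3P: TP => /perm_mem P _ _ vn.
have: v \in values by rewrite P mem_iota; lia.
by case/imageP=> -[r j] _ ->; exists r, j.
Qed.

Lemma syt_inj : injective (fun x : 'I_3 * 'I_n => T x.1 x.2).
Proof.
case/and3P: TP => P _ _; apply/injectiveP.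
by rewrite /injectiveb /dinjectiveb (perm_uniq P) iota_uniq.
Qed.

Lemma syt_row r (j1 j2 : 'I_n) : j1 < j2 -> T r j1 < T r j2.
Proof. by case/and3P: TP => _ /forallP/(_ r)/'forall_forallP/(_ j1 j2)/implyP. Qed.

Lemma syt_col j (r1 r2 : 'I_3) : r1 < r2 -> T r1 j < T r2 j.
Proof. by case/and3P: TP => _ _ /forallP/(_ j)/'forall_forallP/(_ r1 r2)/implyP. Qed.

Lemma row_ofE r j : row_of T (T r j) = r.
Proof.
rewrite /row_of; case: pickP => [[r' j'] /eqP/= E|/(_ (r, j))]; last by rewrite eqxx.
by have [-> _] := @syt_inj (r', j') (r, j) E.
Qed.

(** Since rows increase, the entries at most [v] fill an initial segment of row [r]. *)
Lemma row_countP r j v : (T r j <= v) = (j < row_count T r v).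
Proof.
have le_row (j1 j2 : 'I_n) : j1 <= j2 -> T r j1 <= T r j2.
  by rewrite leq_eqVlt => /orP[/eqP/val_inj -> //|/(syt_row r)/ltnW].
have cardlt k : k <= n -> #|[set j' : 'I_n | j' < k]| = k.
  move=> kn; have winj : injective (widen_ord kn).
    by move=> i i' /(congr1 val) /= /val_inj.
  rewrite -[RHS]card_ord -(card_imset _ winj).
  apply: eq_card => i; rewrite inE; apply/idP/imsetP => [ik|[i' _ ->] //=].
  by exists (Ordinal ik) => //; apply: val_inj.
apply/idP/idP => [Tv|].
  rewrite -(cardlt j.+1) //; apply: subset_leq_card; apply/subsetP => i.
  by rewrite !inE => ij; apply: leq_trans Tv; apply: le_row.
apply: contraTT; rewrite -ltnNge -leqNgt => vT.
rewrite -[leqRHS](cardlt j) ?(ltnW (ltn_ord j)) //.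
apply: subset_leq_card; apply/subsetP => i.
rewrite !inE => Tiv; rewrite ltnNge; apply/negP => /le_row; lia.
Qed.

Lemma row_count0 r : row_count T r 0 = 0.
Proof.
apply/eqP; rewrite cards_eq0; apply/eqP/setP => j; rewrite !inE.
by have := syt_bound r j; lia.
Qed.

Lemma row_count_max r : row_count T r (3 * n) = n.
Proof.
rewrite -[RHS]card_ord -cardsT; congr #|pred_of_set _|; apply/setP => j.
by rewrite !inE; have := syt_bound r j; lia.
Qed.

Lemma row_countS r v : v < 3 * n ->
  row_count T r v.+1 = (row_of T v.+1 == r) + row_count T r v.
Proof.
move=> vn; have [//|r' [j E]] := @syt_onto v.+1; rewrite -{2}E row_ofE.
have [e|ne] := eqVneq r' r; last first.
  rewrite (_ : (_ == _) = false); last by apply: contra_neqF ne => /eqP/val_inj.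
  congr #|pred_of_set _|; apply/setP => i; rewrite !inE leq_eqVlt ltnS.
  case: eqP => //= Ei; have [e _] := @syt_inj (r, i) (r', j) (etrans Ei (esym E)).
  by rewrite e eqxx in ne.
rewrite -e eqxx (_ : _ + _ = #|j |: [set i | T r' i <= v]|).
  congr #|pred_of_set _|; apply/setP => i; rewrite !inE leq_eqVlt ltnS -E.
  congr (_ || _); apply/eqP/eqP => [Ei|-> //].
  by have [] := @syt_inj (r', i) (r', j) Ei.
by rewrite cardsU1 inE E ltnn.
Qed.

Lemma cnt_row_word (r : 'I_3) v : v <= 3 * n ->
  cnt r (row_word T v) = row_count T r v.
Proof.
elim: v => [|v IH] vn; first by rewrite row_count0.
by rewrite /= cnt_cons IH ?row_countS //; lia.
Qed.

Lemma ballot_row_word v : v <= 3 * n -> ballot (row_word T v).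
Proof.
elim: v => [|v IH] // vn; have [//|r [j E]] := @syt_onto v.+1.
rewrite [row_word _ _]/= [ballot _]/= IH; last by lia.
rewrite -E row_ofE ltn_ord /=; have [//|r0] := eqVneq (r : nat) 0.
have r1 : r.-1 < 3 by have := ltn_ord r; lia.
have := @cnt_row_word r v; have := @cnt_row_word (Ordinal r1) v => /= -> ; last by lia.
move=> ->; last by lia.
(* Columns increase, so the row above has an entry at most [v] wherever row [r] has one, and also in
   the column [j] of the value [v.+1]. *)
apply: proper_card; apply/properP; split.
  apply/subsetP => i; rewrite !inE; apply: leq_trans; apply: ltnW.
  by apply: syt_col => /=; lia.
exists j; rewrite inE -ltnS -E ?ltnn //.
by apply: syt_col => /=; lia.
Qed.

Lemma yamanouchi_row_word : yamanouchi n (row_word T (3 * n)).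
Proof.
split=> [|h h3]; first exact: ballot_row_word.
by have := @cnt_row_word (Ordinal h3) (3 * n) (leqnn _) => /= ->; rewrite row_count_max.
Qed.

End Tableaux.

Lemma size_row_word n (T : 'M[nat]_(3, n)) v : size (row_word T v) = v.
Proof. by elim: v => //= v ->. Qed.

Lemma drop_row_word n (T : 'M[nat]_(3, n)) u v :
  drop u (row_word T (u + v)) = row_word T v.
Proof. by elim: u => [|u IH] //=; rewrite drop0. Qed.

Lemma nth_row_word n (T : 'M[nat]_(3, n)) v i : i < v ->
  nth 0 (row_word T v) i = row_of T (v - i).
Proof. by elim: v i => [|v IH] [|i] //= iv; rewrite IH. Qed.

(** The word determines all row counts, and by [row_countP] these determine the entries. *)
Lemma row_word_inj n (T1 T2 : 'M[nat]_(3, n)) :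
  is_rect_SYT T1 -> is_rect_SYT T2 ->
  row_word T1 (3 * n) = row_word T2 (3 * n) -> T1 = T2.
Proof.
move=> P1 P2 E; apply/matrixP => r j.
have EN v : v <= 3 * n -> row_count T1 r v = row_count T2 r v.
  move=> vn; rewrite -!cnt_row_word // -(drop_row_word T1 (3 * n - v)).
  by rewrite -(drop_row_word T2 (3 * n - v)) subnK // E.
have := syt_bound P1 r j; have := syt_bound P2 r j => /andP[_ b2] /andP[_ b1].
apply/eqP; rewrite eqn_leq (row_countP P1) EN // -(row_countP P2) leqnn.
by rewrite (row_countP P2) -EN // -(row_countP P1) leqnn.
Qed.

Lemma row_word_surj n w : yamanouchi n w ->
  exists2 T : 'M[nat]_(3, n), is_rect_SYT T & row_word T (3 * n) = w.
Proof.
move=> Y; have [bw cn] := Y; have sw := yamanouchi_size Y.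
(* [M r v] counts the letters [r] among the first [v] in reading order; the entry [T r j] is the
   position of the letter [r] with 0-based rank [j]. *)
pose M r v := cnt r (drop (3 * n - v) w).
have M0 r : M r 0 = 0 by rewrite /M subn0 drop_oversize // sw.
have Mn (r : 'I_3) : M r (3 * n) = n by rewrite /M subnn drop0 cn.
have MS r v : v < 3 * n -> M r v.+1 = (nth 0 w (3 * n - v.+1) == r) + M r v.
  move=> vn; rewrite /M (drop_nth 0) ?cnt_cons; last by lia.
  by congr (_ + cnt _ (drop _ _)); lia.
have Mb v (r1 r2 : 'I_3) : r1 < r2 -> M r2 v <= M r1 v.
  have /ballot_count : ballot (drop (3 * n - v) w).
    by apply: (@ballot_catr (take (3 * n - v) w)); rewrite cat_take_drop.
  by rewrite /M; case: r1 r2 => [[|[|[|?]]] ?] [[|[|[|?]]] ?] //=; lia.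
have exT (r : 'I_3) (j : 'I_n) : exists v, (v <= 3 * n) && (j < M r v).
  by exists (3 * n); rewrite leqnn Mn ltn_ord.
pose T := (\matrix_(r < 3, j < n) ex_minn (exT r j))%R.
have TP r j : [/\ 0 < T r j <= 3 * n, M r (T r j).-1 = j, M r (T r j) = j.+1
                & nth 0 w (3 * n - T r j) = r].
  rewrite mxE; case: ex_minnP => v /andP[vn jM] min.
  case: v vn jM min => [|v] vn jM min; first by rewrite M0 in jM.
  have lt : ~~ (j < M r v) by apply/negP => lt; have := min v; rewrite lt; lia.
  have e : nth 0 w (3 * n - v.+1) = r.
    apply/eqP; apply: contraT => ne; move: jM; rewrite MS // (negbTE ne); lia.
  by move: jM; rewrite MS // e eqxx /= => jM; split=> //; lia.
have Tle (r : 'I_3) (j : 'I_n) v : v <= 3 * n -> j < M r v -> T r j <= v.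
  by move=> vn jM; rewrite mxE; case: ex_minnP => u _; apply; rewrite vn.
have Tinj : injective (fun x : 'I_3 * 'I_n => T x.1 x.2).
  move=> [r1 j1] [r2 j2] /= E; have [_ _ m1 n1] := TP r1 j1.
  have [_ _ m2 n2] := TP r2 j2; have er : r1 = r2 by apply: val_inj => /=; rewrite -n1 E n2.
  by congr (_, _) => //; apply: val_inj; subst r2; move: m1; rewrite E m2 => -[].
have SYT : is_rect_SYT T.
  apply/and3P; split.
  - have us : uniq [seq T x.1 x.2 | x : 'I_3 * 'I_n].
      by rewrite map_inj_uniq ?enum_uniq.
    apply: uniq_perm; rewrite ?iota_uniq //.
    (* Distinct entries, [3 * n] in number and all in range, exhaust the range. *)
    apply: (fun H1 H2 => (uniq_min_size us H1 H2).2) => [v /imageP[[r j] _ ->]|].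
      by have [? _ _ _] := TP r j; rewrite mem_iota /=; lia.
    by rewrite size_iota size_image card_prod !card_ord.
  - apply/forallP => r; apply/'forall_forallP => j1 j2; apply/implyP => lt.
    have [b2 m2 _ _] := TP r j2; have := @Tle r j1 (T r j2).-1.
    by rewrite m2; lia.
  apply/forallP => j; apply/'forall_forallP => r1 r2; apply/implyP => lt.
  have [b2 _ m2 n2] := TP r2 j; have [_ _ _ n1] := TP r1 j.
  rewrite ltn_neqAle; apply/andP; split.
    by apply/eqP => E; move: n1 lt; rewrite E n2 => ->; rewrite ltnn.
  by apply: Tle; [lia | have := Mb (T r2 j) _ _ lt; lia].
exists T => //; apply: (@eq_from_nth _ 0); rewrite size_row_word ?sw // => i i3.
rewrite nth_row_word //; have [|r [j E]] := @syt_onto _ _ SYT (3 * n - i); first by lia.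
by rewrite -E row_ofE //; have [_ _ _ <-] := TP r j; rewrite E subKn // ltnW.
Qed.

(** * The bijection *)

Definition letters m (p : 'S_m) : seq nat := [seq val (p i) | i <- enum 'I_m].

Lemma size_letters m (p : 'S_m) : size (letters p) = m.
Proof. by rewrite size_map size_enum_ord. Qed.

Lemma nth_letters m (p : 'S_m) (i : 'I_m) : nth 0 (letters p) i = p i.
Proof. by rewrite (nth_map i) ?size_enum_ord // nth_ord_enum. Qed.

Lemma letters_inj m : injective (@letters m).
Proof.
by move=> p q E; apply/permP => i; apply: val_inj; rewrite /= -!nth_letters E.
Qed.

Lemma perm_letters m (p : 'S_m) : perm_eq (letters p) (iota 0 m).
Proof.
rewrite -val_enum_ord /letters map_comp; apply: perm_map.
apply: uniq_perm; rewrite ?enum_uniq //.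
  by rewrite map_inj_uniq ?enum_uniq //; apply: perm_inj.
move=> x; rewrite mem_enum; apply/mapP; exists (p^-1%g x); rewrite ?mem_enum //.
by rewrite permKV.
Qed.

Lemma letters_surj m s : perm_eq s (iota 0 m) -> exists p : 'S_m, letters p = s.
Proof.
move=> P; have us : uniq s by rewrite (perm_uniq P) iota_uniq.
have ss : size s = m by rewrite (perm_size P) size_iota.
have lt (i : 'I_m) : nth 0 s i < m.
  by have := mem_nth 0 (_ : i < size s); rewrite (perm_mem P) mem_iota; apply; rewrite ss.
have inj : injective (fun i => Ordinal (lt i)).
  move=> i j /(congr1 val) /= /eqP; rewrite nth_uniq ?ss // => /eqP.
  exact: val_inj.
exists (perm inj); apply: (@eq_from_nth _ 0); rewrite size_letters ?ss // => i im.
by rewrite -[i]/(val (Ordinal im)) nth_letters permE.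
Qed.

(** * The conditions on permutations, read on their lists of letters *)

Lemma subseq_consP x (l s : seq nat) : subseq (x :: l) s <->
  exists i, [/\ i < size s, nth 0 s i = x & subseq l (drop i.+1 s)].
Proof.
elim: s => [|y s IH]; first by split=> // -[i []].
split.
  rewrite [subseq _ _]/=; case: eqP => [-> sub|_ /IH[i [? ? ?]]]; last by exists i.+1.
  by exists 0; rewrite drop1.
case=> -[|i] [lt E sub]; rewrite [subseq _ _]/=.
  by rewrite -E /= eqxx; rewrite /= drop0 in sub.
case: eqP => _; last by apply/IH; exists i.
by apply: subseq_trans sub _; rewrite /= drop_subseq.
Qed.

Lemma subseq4P x1 x2 x3 x4 (s : seq nat) : subseq [:: x1; x2; x3; x4] s <->
  exists i1 i2 i3 i4, [/\ i1 < i2, i2 < i3, i3 < i4, i4 < size s &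
    [/\ nth 0 s i1 = x1, nth 0 s i2 = x2, nth 0 s i3 = x3 & nth 0 s i4 = x4]].
Proof.
split.
  case/subseq_consP=> i1 [lt1 e1] /subseq_consP[i2 [lt2 e2]].
  rewrite drop_drop => /subseq_consP[i3 [lt3 e3]].
  rewrite drop_drop => /subseq_consP[i4 [lt4 e4 _]].
  rewrite !nth_drop in e2 e3 e4; rewrite !size_drop in lt2 lt3 lt4.
  do 4!eexists; split; [..|split; [exact: e1|exact: e2|exact: e3|exact: e4]]; lia.
case=> i1 [i2 [i3 [i4 [l1 l2 l3 l4 [<- <- <- <-]]]]].
apply/subseq_consP; exists i1; split=> //; first by lia.
apply/subseq_consP; exists (i2 - i1.+1); rewrite size_drop nth_drop drop_drop.
split; [lia | by congr nth; lia |].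
apply/subseq_consP; exists (i3 - i2.+1); rewrite size_drop nth_drop drop_drop.
split; [lia | by congr nth; lia |].
apply/subseq_consP; exists (i4 - i3.+1); rewrite size_drop nth_drop sub0seq.
by split; [lia | by congr nth; lia |].
Qed.

Lemma down_upP m (p : 'S_m) : reflect (alternating (letters p)) (down_up p).
Proof.
apply: (iffP idP) => [/'forall_forallP H i|H].
  rewrite size_letters => lt; have lt' : i < m by lia.
  have /implyP := H (Ordinal lt') (Ordinal lt); rewrite /= eqxx => /(_ isT).
  by rewrite -!nth_letters.
apply/'forall_forallP => i j; apply/implyP => /eqP E.
by have := H i; rewrite size_letters -E !nth_letters; apply; apply: ltn_ord.
Qed.

Lemma avoids_4123P m (p : 'S_m) :
  reflect (avoids (letters p)) (~~ contains_4123 p).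
Proof.
apply: (iffP negP) => [H x y z t /subseq4P|H].
  rewrite size_letters => -[i1 [i2 [i3 [i4 [l1 l2 l3 l4]]]]].
  have [k1 k2 k3] : [/\ i1 < m, i2 < m & i3 < m] by split; lia.
  rewrite -[i1]/(val (Ordinal k1)) -[i2]/(val (Ordinal k2)).
  rewrite -[i3]/(val (Ordinal k3)) -[i4]/(val (Ordinal l4)) !nth_letters.
  move=> [<- <- <- <-] [lt1 lt2 lt3]; case: H.
  apply/existsP; exists (Ordinal k1); apply/existsP; exists (Ordinal k2).
  apply/existsP; exists (Ordinal k3); apply/existsP; exists (Ordinal l4).
  by apply/and5P; split=> //; apply/andP.
case/existsP=> i1 /existsP[i2 /existsP[i3 /existsP[i4]]].
case/and5P=> l1 l2 l3 lt1 /andP[lt2 lt3].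
apply: (H (p i1) (p i2) (p i3) (p i4)) => //.
by apply/subseq4P; exists i1, i2, i3, i4; rewrite size_letters !nth_letters.
Qed.

Lemma du4123_letters n (p : 'S_(2 * n)) :
  du4123 n (letters p) <-> down_up p && ~~ contains_4123 p.
Proof.
split=> [[_ /down_upP -> /avoids_4123P] //|/andP[/down_upP alt /avoids_4123P av]].
by split=> //; rewrite -mul2n perm_letters.
Qed.

(** Codes are only known to exist, so both maps are obtained by choice. *)
Lemma bijection_of_relation (A B : Type) (R : A -> B -> Prop) :
  (forall a, exists b, R a b) -> (forall b, exists a, R a b) ->
  (forall a b1 b2, R a b1 -> R a b2 -> b1 = b2) ->
  (forall a1 a2 b, R a1 b -> R a2 b -> a1 = a2) ->
  exists f : A -> B, bijective f /\ forall a, R a (f a).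
Proof.
move=> exB exA uB uA.
pose f a := proj1_sig (constructive_indefinite_description _ (exB a)).
pose g b := proj1_sig (constructive_indefinite_description _ (exA b)).
have fP a : R a (f a) by rewrite /f; case: constructive_indefinite_description.
have gP b : R (g b) b by rewrite /g; case: constructive_indefinite_description.
exists f; split=> //; exists g => [a|b].
  exact: uA (gP _) (fP _).
exact: uB (fP _) (gP _).
Qed.

(** The largest entry of the first row is the position of the last 0, which [(top c).+1] letters
    follow. *)
Lemma last_of_first_row n (hn : 0 < n) (T : SYT3 n) c : valid_code c -> size c = n ->
  word_of c = row_word (val T) (3 * n) -> entry1n hn T = 3 * n - (top c).+1.
Proof.
move=> vc sc Ec; have tc := valid_top vc; have [_ N0 Z0 _] := word_of_sound vc.
have TP := valP T; rewrite Ec size_row_word in N0; rewrite Ec in Z0.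
rewrite /entry1n; set j := Ordinal _; set v := (val T ord0 j).
have /andP[v0 vn] : 0 < v <= 3 * n := syt_bound TP ord0 j.
have le1 : top c < 3 * n - v.
  rewrite ltnNge; apply/negP => /N0; rewrite nth_row_word; last by lia.
  by rewrite subKn // (row_ofE TP) => /(_ _)/eqP [] //; lia.
have [|r [j' E]] := @syt_onto _ _ TP (3 * n - (top c).+1); first by lia.
move: Z0; rewrite nth_row_word; last by lia.
rewrite -E row_ofE // => r0.
have {}r0 : r = ord0 by apply: val_inj.
have : val T ord0 j' <= v; last by rewrite -r0 E; lia.
have : j' <= j by rewrite /=; have := ltn_ord j'; lia.
by rewrite leq_eqVlt => /orP[/eqP/val_inj -> //|/(syt_row TP ord0)/ltnW].
Qed.

Theorem theorem2p8 (n : nat) (hn : 0 < n) :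
  exists f : DU4123 (2 * n) -> SYT3 n,
    bijective f /\
    forall pi : DU4123 (2 * n),
      entry1n hn (f pi) = 3 * n - first_letter hn pi.
Proof.
(* A permutation corresponds to a tableau when they share a valid code. *)
pose R (pi : DU4123 (2 * n)) (T : SYT3 n) := exists c, [/\ valid_code c, size c = n,
  perm_of c = letters (val pi) & word_of c = row_word (val T) (3 * n)].
have [||||f [bij fR]] := @bijection_of_relation _ _ R.
- move=> pi; have /du4123_letters/perm_of_complete[c vc [sc Ec]] := valP pi.
  have [Y _ _ _] := word_of_sound vc; rewrite sc in Y.
  by have [T TP ET] := row_word_surj Y; exists (exist _ T TP), c; rewrite ET.
- move=> T; have [c vc [sc Ec]] := word_of_complete (yamanouchi_row_word (valP T)).
  have [D _ _ _] := perm_of_sound vc; rewrite sc in D.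
  have [p Ep] : exists p : 'S_(2 * n), letters p = perm_of c.
    by apply: letters_surj; case: D; rewrite mul2n.
  rewrite -Ep in D; move/du4123_letters: D => D.
  by exists (exist _ p D), c; rewrite Ep.
- move=> pi T1 T2 [c1 [v1 s1 P1 W1]] [c2 [v2 s2 P2 W2]].
  apply: val_inj; apply: row_word_inj (valP T1) (valP T2) _.
  by rewrite -W1 -W2; congr word_of; apply: perm_of_inj; rewrite P1 P2.
- move=> p1 p2 T [c1 [v1 s1 P1 W1]] [c2 [v2 s2 P2 W2]].
  apply/val_inj/letters_inj; rewrite -P1 -P2; congr perm_of.
  by apply: word_of_inj => //; rewrite ?s1 ?s2 ?W1 ?W2.
exists f; split=> // pi; have [c [vc sc Pc Wc]] := fR pi.
rewrite (last_of_first_row hn vc sc Wc) /first_letter.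
(* [top c] is the first letter counted from 0. *)
have [_ <- _ _] := perm_of_sound vc; rewrite Pc -nth0.
by rewrite -(nth_letters (val pi)).
Qed.
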